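(* Consider the SDE $dx(t)=f(t,x(t))\,dt+G\,d\beta(t)$ with $x(t)\in\mathbb{R}^n$, $f:\mathbb{R}\times\mathbb{R}^n\to\mathbb{R}^n$, $G\in\mathbb{R}^{n\times q}$ constant, and $\beta$ a $q$-dimensional Brownian motion with increment covariance $Q\,dt>0$. On the sampling interval $[t_{k-1},t_k]$ take the equidistant mesh $t_{k-1}=t_{k-1}^{(0)}<t_{k-1}^{(1)}<\ldots<t_{k-1}^{(L)}=t_k$ with step size $\delta=\Delta/L$, $\Delta=t_k-t_{k-1}$, and nodes $t_{k-1}^{(l)}=t_{k-1}+l\delta$, $l=0,\ldots,L-1$. Given the state estimate $\hat x_{k-1|k-1}$ and the filter covariance matrix $P_{k-1|k-1}$ at time $t_{k-1}$, set $\hat x_{k-1|k-1}^{(0)}:=\hat x_{k-1|k-1}$ and $P_{k-1|k-1}^{(0)}:=P_{k-1|k-1}$. If the Euler-Maruyama method $$x_{k-1}^{(l+1)}=f_d^{EM}\bigl(t_{k-1}^{(l)},x_{k-1}^{(l)}\bigr)+G\,\Delta w_l,\qquad f_d^{EM}(t,x)=x+\delta f(t,x),\qquad \Delta w_l\sim\mathcal{N}(\mathbf{0},\delta Q),$$ is applied to the SDE, then the derivative-free EKF framework with scaling parameter $\alpha>0$ (as defined in the context) yields, for $l=0,\ldots,L-1$, the following state and covariance equations: $$\hat x_{k-1|k-1}^{(l+1)}=f_d^{EM}\bigl(t_{k-1}^{(l)},\hat x_{k-1|k-1}^{(l)}\bigr)=\hat x_{k-1|k-1}^{(l)}+\delta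 f\bigl(t_{k-1}^{(l)},\hat x_{k-1|k-1}^{(l)}\bigr),$$ $$P_{k-1|k-1}^{(l+1)}=\overline{\mathbb{F}\mathbb{X}}_{k-1|k-1}^{EM,(l)}\Bigl(\overline{\mathbb{F}\mathbb{X}}_{k-1|k-1}^{EM,(l)}\Bigr)^{\top}+\delta\,GQG^{\top},$$ where the centered and scaled matrix $\overline{\mathbb{F}\mathbb{X}}_{k-1|k-1}^{EM,(l)}\in\mathbb{R}^{n\times n}$ is defined from the $n$ vectors $\mathcal{X}_{i,k-1|k-1}^{(l)}$, $i=1,\ldots,n$, that are the columns of $$\mathbb{X}_{k-1|k-1}^{(l)}=\hat x_{k-1|k-1}^{(l)}\mathbf{1}^{\top}+\frac{\sqrt{n}}{\alpha}\bigl(P_{k-1|k-1}^{(l)}\bigr)^{1/2},$$ propagated (column by column) through the discretized drift: $$\mathbb{F}\mathbb{X}_{k-1|k-1}^{EM,(l)}=f_d^{EM}\bigl(t_{k-1}^{(l)},\mathbb{X}_{k-1|k-1}^{(l)}\bigr),$$ $$\overline{\mathbb{F}\mathbb{X}}_{k-1|k-1}^{EM,(l)}=\frac{\alpha}{\sqrt{n}}\Bigl[\mathbb{F}\mathbb{X}_{k-1|k-1}^{EM,(l)}-f_d^{EM}\bigl(t_{k-1}^{(l)},\hat x_{k-1|k-1}^{(l)}\bigr)\mathbf{1}^{\top}\Bigr].$$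
   Context: Notation. $\mathbf{1}\in\mathbb{R}^n$ is the column vector of ones. For a covariance matrix $P$, $P^{1/2}$ denotes a square matrix square root with $P=P^{1/2}P^{\top/2}$, where $P^{\top/2}:=(P^{1/2})^{\top}$. A function of the state applied to a matrix acts on each column: $f_d(t,[\mathcal{X}_1|\ldots|\mathcal{X}_n])=[f_d(t,\mathcal{X}_1)|\ldots|f_d(t,\mathcal{X}_n)]$. Setting. All expectations are conditional on the measurements available up to $t_{k-1}$. The random vector $x_{k-1}^{(0)}$ has mean $\hat x_{k-1|k-1}^{(0)}$ and covariance $P_{k-1|k-1}^{(0)}$. For each $l$, $\Delta w_l$ is Gaussian with zero mean and covariance $\delta Q$ and is independent of $x_{k-1}^{(l)}$; the random vectors $f_d^{EM}(t_{k-1}^{(l)},x_{k-1}^{(l)})$ are square integrable. By definition, $\hat x_{k-1|k-1}^{(l)}$ and $P_{k-1|k-1}^{(l)}$ denote the mean and the covariance of $x_{k-1}^{(l)}$ computed within the derivative-free EKF framework. Derivative-free EKF framework (with scaling parameter $\alpha>0$). Given a random vector $x\in\mathbb{R}^n$ with mean $\hat x$ and covariance $P$, put $[\xi_1|\ldots|\xi_n]=\sqrt{n}\,P^{1/2}$, so that $P=\frac1n\sum_{i=1}^n\xi_i\xi_i^{\top}$, and $\mathcal{X}_i=\hat x+\frac1\alpha\xi_i$, $i=1,\ldots,n$. The framework closes the moment computations for the discretized drift $g(\cdot)=f_d^{EM}(t_{k-1}^{(l)},\cdot)$ (with $x=x_{k-1}^{(l)}$, $\hat x=\hat x_{k-1|k-1}^{(l)}$,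 $P=P_{k-1|k-1}^{(l)}$) by the rules (i) $\mathbf{E}\{g(x)\}=g(\hat x)$; (ii) $\mathbf{var}\{g(x)\}:=\mathbf{E}\{[g(x)-\mathbf{E}\{g(x)\}][g(x)-\mathbf{E}\{g(x)\}]^{\top}\}=\frac{\alpha^2}{n}\sum_{i=1}^n[g(\mathcal{X}_i)-g(\hat x)][g(\mathcal{X}_i)-g(\hat x)]^{\top}$, while the moments of the noise are evaluated exactly. ''The derivative-free EKF framework yields the state and covariance equations'' means: when rules (i) and (ii) are taken as equalities at every step $l$, the mean $\mathbf{E}\{x_{k-1}^{(l+1)}\}$ and the covariance $\mathbf{E}\{[x_{k-1}^{(l+1)}-\hat x_{k-1|k-1}^{(l+1)}][x_{k-1}^{(l+1)}-\hat x_{k-1|k-1}^{(l+1)}]^{\top}\}$ are given by the stated formulas. *)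

(* Defs.v *)
From HB Require Import structures.
From mathcomp Require Import all_boot all_order all_algebra.
From mathcomp Require Import all_classical all_reals all_analysis.

Set Implicit Arguments.
Unset Strict Implicit.
Unset Printing Implicit Defensive.

Import Order.TTheory GRing.Theory Num.Theory.
Import numFieldNormedType.Exports.

Local Open Scope classical_set_scope.
Local Open Scope ring_scope.

Definition borelV (R : realType) (n : nat) :=
  g_sigma_algebraType (@open 'cV[R]_n).

Definition posdefmx (R : realType) (q : nat) (Q : 'M[R]_q) : Prop :=
  Q^T = Q /\ forall v : 'cV[R]_q, v != 0 -> 0 < (v^T *m Q *m v) 0 0.

(* Entrywise expectation.  [fine] is only meaningful for integrable entries,
   which holds wherever the expectations of square integrable vectors and of
   products of two of their coordinates are taken. *)
Definition Emx d (T : measurableType d) (R : realType) (P : probability T R)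
    (m n : nat) (M : T -> 'M[R]_(m, n)) : 'M[R]_(m, n) :=
  \matrix_(i, j) fine ('E_P[fun w => M w i j])%E.

Definition covmx d (T : measurableType d) (R : realType) (P : probability T R)
    (n : nat) (X : T -> 'cV[R]_n) : 'M[R]_n :=
  Emx P (fun w => (X w - Emx P X) *m (X w - Emx P X)^T).

Definition square_integrable d (T : measurableType d) (R : realType)
    (P : probability T R) (n : nat) (X : T -> 'cV[R]_n) : Prop :=
  forall i, (fun w => X w i 0) \in Lfun P 2%:E.

Definition independent_vectors d (T : measurableType d) (R : realType)
    (P : probability T R) (n q : nat) (X : T -> 'cV[R]_n) (Y : T -> 'cV[R]_q) :
    Prop :=
  forall (A : set (borelV R n)) (B : set (borelV R q)),
    measurable A -> measurable B ->
    P (X @^-1` A `&` Y @^-1` B) = (P (X @^-1` A) * P (Y @^-1` B))%E.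

(* Univariate normal law with mean m and variance v >= 0.  The library's
   [normal_prob] takes the standard deviation and is not a Dirac mass when that
   is 0, hence the separate degenerate case. *)
Definition normal_law (R : realType) (m v : R) (A : set R) : \bar R :=
  if 0 < v then normal_prob m (Num.sqrt v) A else \d_m A.

(* X ~ N(m, S), for S symmetric positive semidefinite: every linear functional
   a^T X has the univariate law N(a^T m, a^T S a). *)
Definition gaussian_vector d (T : measurableType d) (R : realType)
    (P : probability T R) (q : nat) (X : T -> 'cV[R]_q)
    (m : 'cV[R]_q) (S : 'M[R]_q) : Prop :=
  measurable_fun [set: T] (X : T -> borelV R q) /\
  forall (a : 'cV[R]_q) (A : set R), measurable A ->
    P [set w | A ((a^T *m X w) 0 0)] =
    normal_law ((a^T *m m) 0 0) ((a^T *m S *m a) 0 0) A.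

Definition mesh_step (R : realType) (t0 t1 : R) (L : nat) : R := (t1 - t0) / L%:R.

Definition mesh_node (R : realType) (t0 t1 : R) (L l : nat) : R :=
  t0 + l%:R * mesh_step t0 t1 L.

Definition f_EM (R : realType) (n : nat) (f : R -> 'cV[R]_n -> 'cV[R]_n)
    (delta t : R) (x : 'cV[R]_n) : 'cV[R]_n :=
  x + delta *: f t x.

Definition map_cols (R : realType) (n p : nat) (g : 'cV[R]_n -> 'cV[R]_n)
    (X : 'M[R]_(n, p)) : 'M[R]_(n, p) :=
  \matrix_(i, j) g (col j X) i 0.

(* In the definitions below S is a chosen square root of a covariance matrix,
   i.e. the covariance is S *m S^T. *)

Definition xi_vec (R : realType) (n : nat) (S : 'M[R]_n) (i : 'I_n) : 'cV[R]_n :=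
  col i (Num.sqrt n%:R *: S).

Definition sample_point (R : realType) (n : nat) (alpha : R)
    (xhat : 'cV[R]_n) (S : 'M[R]_n) (i : 'I_n) : 'cV[R]_n :=
  xhat + alpha^-1 *: xi_vec S i.

(* The moment-closure rules of the derivative-free EKF framework for g(x), where
   x has mean xhat and covariance S *m S^T, read as equalities between the
   actual moments of g(x) and their approximations. *)
Definition df_ekf_mean_rule d (T : measurableType d) (R : realType)
    (P : probability T R) (n : nat) (x : T -> 'cV[R]_n) (xhat : 'cV[R]_n)
    (g : 'cV[R]_n -> 'cV[R]_n) : Prop :=
  Emx P (fun w => g (x w)) = g xhat.

Definition df_ekf_cov_rule d (T : measurableType d) (R : realType)
    (P : probability T R) (n : nat) (alpha : R) (x : T -> 'cV[R]_n)
    (xhat : 'cV[R]_n) (S : 'M[R]_n) (g : 'cV[R]_n -> 'cV[R]_n) : Prop :=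
  covmx P (fun w => g (x w)) =
  (alpha ^+ 2 / n%:R) *:
    \sum_(i < n) (g (sample_point alpha xhat S i) - g xhat) *m
                 (g (sample_point alpha xhat S i) - g xhat)^T.

Definition ones (R : realType) (n : nat) : 'cV[R]_n := const_mx 1.

Definition XX (R : realType) (n : nat) (alpha : R) (xhat : 'cV[R]_n)
    (S : 'M[R]_n) : 'M[R]_n :=
  xhat *m (ones R n)^T + (Num.sqrt n%:R / alpha) *: S.

Definition FX (R : realType) (n : nat) (alpha : R) (xhat : 'cV[R]_n)
    (S : 'M[R]_n) (g : 'cV[R]_n -> 'cV[R]_n) : 'M[R]_n :=
  map_cols g (XX alpha xhat S).

Definition FXbar (R : realType) (n : nat) (alpha : R) (xhat : 'cV[R]_n)
    (S : 'M[R]_n) (g : 'cV[R]_n -> 'cV[R]_n) : 'M[R]_n :=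
  (alpha / Num.sqrt n%:R) *: (FX alpha xhat S g - g xhat *m (ones R n)^T).

(* Main.v *)
Require Import Defs.
From HB Require Import structures.
From mathcomp Require Import all_boot all_order all_algebra.
From mathcomp Require Import all_classical all_reals all_analysis.
From mathcomp Require Import measurable_realfun.
From mathcomp Require Import ring lra.

Set Implicit Arguments.
Unset Strict Implicit.
Unset Printing Implicit Defensive.

Import Order.TTheory GRing.Theory Num.Theory.
Import numFieldNormedType.Exports.

Local Open Scope classical_set_scope.
Local Open Scope ring_scope.

(** One Euler-Maruyama step is [x l.+1 = Y + G *m dw l], where [Y] is the
    discretized drift at [x l] and the increment [dw l] is centred Gaussian and
    independent of [x l].  Expectation is linear and the noise is centred, so
    the mean of [x l.+1] is the mean of [Y], which the mean rule equates with
    the drift at the estimate.  [Y] and [dw l] are independent and square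
    integrable, hence uncorrelated ([independent_vectors_covariance0]), so the
    covariance of [x l.+1] is [covmx Y + G *m covmx (dw l) *m G^T]
    ([covmxD_uncorrelated], [covmx_mulmx]).  The covariance rule turns the first
    term into a normalized sum of outer products over the sample points, which
    is the Gram matrix of the centred and scaled propagated ensemble
    ([FXbar_gram]); the second term is [delta *: (G *m Q *m G^T)] once the
    covariance of [dw l] is known.

    A Gaussian vector is described here only through the laws of its linear
    functionals, so the analytic part consists in recovering its moments from
    them ([gaussian_vector_moments]).  The functionals for [a] and [- a] have
    the same law, so each has mean zero.  The second moment of a univariate
    normal law is its variance, by integration by parts
    ([normal_prob_second_moment]); this gives the quadratic form of the
    covariance matrix, and a symmetric matrix is determined by its quadratic
    form ([quadratic_form_inj]). *)

(** * Moments of random vectors *)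

Section vector_moments.
Context d (T : measurableType d) (R : realType) (P : probability T R).

Lemma Lfun2_Lfun1 (X : T -> R) : X \in Lfun P 2%:E -> X \in Lfun P 1.
Proof. by apply: Lfun_subset12; exact: fin_num_measure. Qed.

Lemma Emx_tr m n (M : T -> 'M[R]_(m, n)) :
  Emx P (fun w => (M w)^T) = (Emx P M)^T.
Proof.
apply/matrixP => i j; rewrite !mxE; congr (fine 'E_P[_]%E).
by apply/funext => w; rewrite mxE.
Qed.

Lemma Lfun_mulmxl m n p (r : R) (A : 'M[R]_(m, n)) (M : T -> 'M[R]_(n, p)) :
  1 <= r -> (forall i j, (fun w => M w i j) \in Lfun P r%:E) ->
  forall i j, (fun w => (A *m M w) i j) \in Lfun P r%:E.
Proof.
move=> r1 Mr i j.
rewrite (_ : (fun _ => _) = \sum_k (A i k \o* (fun w => M w k j))); last first.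
  apply/funext => w; rewrite fct_sumE mxE; apply: eq_bigr => k _.
  by rewrite /= mulrC.
by apply: rpred_sum => k _; exact: Lfun_scale.
Qed.

Lemma Emx_mulmxl m n p (A : 'M[R]_(m, n)) (M : T -> 'M[R]_(n, p)) :
  (forall i j, (fun w => M w i j) \in Lfun P 1) ->
  Emx P (fun w => A *m M w) = A *m Emx P M.
Proof.
move=> M1; apply/matrixP => i j; rewrite !mxE.
pose F k : T -> R := A i k \o* (fun w => M w k j).
have F1 k : F k \in Lfun P 1 by exact: Lfun_scale.
rewrite [X in 'E_P[X]%E](_ : _ =
    \sum_(f <- [seq F k | k : 'I_n]) f); last first.
  apply/funext => w; rewrite mxE big_map fct_sumE big_enum /=.
  by apply: eq_bigr => k _; rewrite /F /= mulrC.
rewrite expectation_sum => [|_ /mapP[k _ ->]//].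
rewrite big_map big_enum /= -sum_fine => [|k _];
  last exact: expectation_fin_num.
apply: eq_bigr => k _.
by rewrite /F expectationZl// fineM ?expectation_fin_num// mxE.
Qed.

Lemma Emx_mulmxr m n p (M : T -> 'M[R]_(m, n)) (B : 'M[R]_(n, p)) :
  (forall i j, (fun w => M w i j) \in Lfun P 1) ->
  Emx P (fun w => M w *m B) = Emx P M *m B.
Proof.
move=> M1; apply: trmx_inj; rewrite trmx_mul -!Emx_tr -Emx_mulmxl => [|i j].
  by congr Emx; apply/funext => w; rewrite trmx_mul.
rewrite [X in X \in _](_ : _ = fun w => M w j i)//.
by apply/funext => w; rewrite mxE.
Qed.

Lemma EmxD m n (M N : T -> 'M[R]_(m, n)) :
  (forall i j, (fun w => M w i j) \in Lfun P 1) ->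
  (forall i j, (fun w => N w i j) \in Lfun P 1) ->
  Emx P (fun w => M w + N w) = Emx P M + Emx P N.
Proof.
move=> M1 N1; apply/matrixP => i j; rewrite !mxE.
rewrite -fineD ?expectation_fin_num// -expectationD//.
by congr (fine 'E_P[_]%E); apply/funext => w; rewrite mxE.
Qed.

Lemma covmxE n (X : T -> 'cV[R]_n) i j :
  covmx P X i j = fine (covariance P (fun w => X w i 0) (fun w => X w j 0)).
Proof.
rewrite !mxE covariance.unlock; congr (fine 'E_P[_]%E).
by apply/funext => w; rewrite !mxE big_ord1 !mxE.
Qed.

Lemma covmx_tr n (X : T -> 'cV[R]_n) : (covmx P X)^T = covmx P X.
Proof. by apply/matrixP => i j; rewrite mxE !covmxE covarianceC. Qed.

Lemma square_integrable_entry n (X : T -> 'cV[R]_n) i (j : 'I_1) :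
  square_integrable P X -> (fun w => X w i j) \in Lfun P 2%:E.
Proof. by rewrite (ord1 j). Qed.

(** Centring commutes with [A], so the outer product of the centred vector is
    multiplied by [A] on the left and by [A^T] on the right, and both factors
    leave the expectation. *)
Lemma covmx_mulmx m n (A : 'M[R]_(m, n)) (X : T -> 'cV[R]_n) :
  square_integrable P X ->
  covmx P (fun w => A *m X w) = A *m covmx P X *m A^T.
Proof.
move=> X2; have X1 i j : (fun w => X w i j) \in Lfun P 1.
  exact/Lfun2_Lfun1/square_integrable_entry.
pose D w := X w - Emx P X.
have DD1 i j : (fun w => (D w *m (D w)^T) i j) \in Lfun P 1.
  have D2 k : (fun w => D w k 0) \in Lfun P 2%:E.
    rewrite [X in X \in _](_ : _ = (fun w => X w k 0) - cst (Emx P X k 0)).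
      by apply: rpredB => [|Hyp|Hyp]; rewrite ?lee1n ?Lfun_cst.
    by apply/funext => w; rewrite !mxE.
  rewrite [X in X \in _](_ : _ = (fun w => D w i 0) \* (fun w => D w j 0)).
    exact: Lfun2_mul_Lfun1.
  by apply/funext => w; rewrite mxE big_ord1 [X in _ * X]mxE.
rewrite -(Emx_mulmxl A DD1) -Emx_mulmxr; last exact: Lfun_mulmxl.
rewrite /covmx (Emx_mulmxl A X1); congr Emx; apply/funext => w.
by rewrite -mulmxBr trmx_mul !mulmxA.
Qed.

Lemma covmxD_uncorrelated n (Y Z : T -> 'cV[R]_n) :
  square_integrable P Y -> square_integrable P Z ->
  (forall i j, covariance P (fun w => Y w i 0) (fun w => Z w j 0) = 0%E) ->
  covmx P (fun w => Y w + Z w) = covmx P Y + covmx P Z.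
Proof.
move=> Y2 Z2 YZ0; apply/matrixP => i j; rewrite [RHS]mxE !covmxE.
have addE k :
    (fun w => (Y w + Z w) k 0) = (fun w => Y w k 0) \+ (fun w => Z w k 0).
  by apply/funext => w; rewrite mxE.
rewrite !addE covarianceDl ?rpredD ?lee1n// !covarianceDr//.
rewrite YZ0 [X in (_ + (X + _))%E]covarianceC YZ0 adde0 add0e fineD//.
  by rewrite covariance_fin_num ?Lfun2_mul_Lfun1 ?Lfun2_Lfun1.
by rewrite covariance_fin_num ?Lfun2_mul_Lfun1 ?Lfun2_Lfun1.
Qed.

End vector_moments.

(** Polarization: the form at [e_i + e_j], minus its values at [e_i] and at
    [e_j], is twice the entry [(i, j)]. *)
Lemma quadratic_form_inj (R : numDomainType) (n : nat) (A B : 'M[R]_n) :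
  A^T = A -> B^T = B ->
  (forall a : 'cV[R]_n, (a^T *m A *m a) 0 0 = (a^T *m B *m a) 0 0) -> A = B.
Proof.
move=> As Bs AB; apply/matrixP => i j.
have e (M : 'M[R]_n) k l :
    ((delta_mx k 0 : 'cV[R]_n)^T *m M *m (delta_mx l 0 : 'cV[R]_n)) 0 0 = M k l.
  by rewrite trmx_delta -rowE -matrix.colE !mxE.
have sym (M : 'M[R]_n) k l : M^T = M -> M l k = M k l.
  by move=> {2}<-; rewrite mxE.
have := AB (delta_mx i 0 + delta_mx j 0).
have addE (U V : 'M[R]_1) : (U + V) 0 0 = U 0 0 + V 0 0 by rewrite mxE.
rewrite [(_ + _)^T]raddfD /= !mulmxDl !mulmxDr !addE !e.
have := AB (delta_mx i 0); have := AB (delta_mx j 0); rewrite !e => -> ->.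
rewrite (sym A i j As) (sym B i j Bs) !addrA => /addIr.
rewrite -!addrA => /addrI.
by rewrite -!mulr2n => /eqP; rewrite eqrMn2r // => /eqP.
Qed.

(** * Independence and covariance *)

(** The Borel sigma-algebra of column vectors is generated by the open sets of
    the matrix topology; coordinates are measurable because they are
    continuous. *)
Lemma measurable_coord (R : realType) (n : nat) (i : 'I_n) :
  measurable_fun [set: borelV R n] (fun v : borelV R n => (v : 'cV[R]_n) i 0).
Proof.
apply: (measurability _ (RGenOInfty.measurableE R)) => _ [_ [a ->] <-].
rewrite setTI; apply: sub_sigma_algebra; rewrite /=.
apply: open_comp; last by rewrite set_itvE; exact: open_gt.
by move=> v _; exact: coord_continuous.
Qed.

Lemma measurable_functional (R : realType) (n : nat) (a : 'cV[R]_n) :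
  measurable_fun [set: borelV R n]
    (fun v : borelV R n => (a^T *m (v : 'cV[R]_n)) 0 0).
Proof.
rewrite (_ : (fun _ => _) =
    fun v : borelV R n => \sum_i a i 0 * (v : 'cV[R]_n) i 0).
  apply: measurable_sum => i.
  by apply: measurable_funM => //; exact: measurable_coord.
by apply/funext => v; rewrite mxE; apply: eq_bigr => i _; rewrite mxE.
Qed.

(** The product rule on preimages says that the joint law of [(X, Y)] agrees
    with the product of the marginal laws on rectangles, hence everywhere;
    Fubini then factors the expectation of [X * Y]. *)
Lemma independent_covariance0 d (T : measurableType d) (R : realType)
    (P : probability T R) (X Y : T -> R) :
  X \in Lfun P 2%:E -> Y \in Lfun P 2%:E ->
  (forall A B : set R, measurable A -> measurable B ->
    P (X @^-1` A `&` Y @^-1` B) = (P (X @^-1` A) * P (Y @^-1` B))%E) ->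
  covariance P X Y = 0%E.
Proof.
move=> X2 Y2 XY.
have X1 := Lfun2_Lfun1 X2.
have Y1 := Lfun2_Lfun1 Y2.
have XY1 : (X * Y)%R \in Lfun P 1 by exact: Lfun2_mul_Lfun1.
have mX : measurable_fun [set: T] X.
  by move: X1; rewrite inE => /andP[/[!inE]].
have mY : measurable_fun [set: T] Y.
  by move: Y1; rewrite inE => /andP[/[!inE]].
pose Xr : {RV P >-> R} := mfun_Sub (mem_set mX : X \in mfun).
pose Yr : {RV P >-> R} := mfun_Sub (mem_set mY : Y \in mfun).
have mXY : measurable_fun [set: T] (fun w => (X w, Y w)).
  exact: measurable_fun_pair.
pose XYr : {RV P >-> (R * R)%type} := mfun_Sub (mem_set mXY : _ \in mfun).
have joint A : measurable A ->
    (distribution P Xr \x distribution P Yr)%E A = distribution P XYr A.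
  by move=> mA; apply: (@product_measure_unique _ _ _ _ _ (distribution P Xr)
    (distribution P Yr) (distribution P XYr)).
rewrite covarianceE//.
suff -> : ('E_P[X * Y] = 'E_P[X] * 'E_P[Y])%E.
  by rewrite subee// fin_numM ?expectation_fin_num.
have mm : measurable_fun [set: R * R] (fun z : R * R => (z.1 * z.2)%:E).
  by apply/measurable_EFinP; apply: measurable_funM.
have iXY := (Lfun1_integrable P (X * Y)).1 XY1.
have iX := (Lfun1_integrable P X).1 X1.
have iY := (Lfun1_integrable P Y).1 Y1.
have EY : (\int[distribution P Yr]_y y%:E = 'E_P[Y])%E.
  by rewrite integral_distribution// unlock.
have EX : (\int[distribution P Xr]_y y%:E = 'E_P[X])%E.
  by rewrite integral_distribution// unlock.
(* Integrability of the product over the product law comes from that of [X * Y]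
   on [T], the joint law being the image of [P]. *)
have iprod : (distribution P Xr \x distribution P Yr)%E.-integrable [set: R * R]
    (fun z : R * R => (z.1 * z.2)%:E).
  have /integrableP[_ ioo] := integrable_pushforward mXY mm iXY measurableT.
  apply/integrableP; split => //.
  by rewrite (eq_measure_integral _ (fun A mA _ => joint A mA)).
transitivity (\int[distribution P XYr]_z (z.1 * z.2)%:E)%E.
  by rewrite integral_distribution// unlock.
rewrite -(eq_measure_integral _ (fun A mA _ => joint A mA)).
rewrite -integral12_prod_meas1//.
rewrite /fubini_F /=.
under eq_integral => u _.
  under eq_integral do rewrite EFinM.
  rewrite integralZl//; last exact: (integrable_pushforward mY _ iY).
  rewrite EY -[X in (_ * X)%E]fineK ?expectation_fin_num//.
  over.
rewrite integralZr//; last exact: (integrable_pushforward mX _ iX).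
by rewrite EX fineK ?expectation_fin_num.
Qed.

(** Independence passes to measurable functions of the two vectors, since a
    preimage under [u \o X] is the preimage under [X] of a measurable set. *)
Lemma independent_vectors_covariance0 d (T : measurableType d) (R : realType)
    (P : probability T R) (n q : nat) (X : T -> 'cV[R]_q) (Y : T -> 'cV[R]_n)
    (u : borelV R q -> R) (v : borelV R n -> R) :
  independent_vectors P X Y ->
  measurable_fun [set: borelV R q] u -> measurable_fun [set: borelV R n] v ->
  (fun w => u (X w)) \in Lfun P 2%:E -> (fun w => v (Y w)) \in Lfun P 2%:E ->
  covariance P (fun w => u (X w)) (fun w => v (Y w)) = 0%E.
Proof.
move=> indXY mu mv u2 v2; apply: independent_covariance0 => // A B mA mB.
apply: (indXY (u @^-1` A) (v @^-1` B)).
- by rewrite -[X in measurable X]setTI; exact: mu.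
- by rewrite -[X in measurable X]setTI; exact: mv.
Qed.

(** * Second moment of the normal law *)

(** The law is defined by integrating its density over sets.  The density and
    the Radon-Nikodym derivative have the same integral over every measurable
    set, so they agree almost everywhere and the density may replace the
    derivative in the change of variables. *)
Lemma ge0_integral_normal_prob (R : realType) (m s : R)
    (f : measurableTypeR R -> \bar R) :
  (forall x, 0 <= f x)%E -> measurable_fun [set: R] f ->
  (\int[normal_prob m s]_x f x =
   \int[lebesgue_measure]_x (f x * (normal_pdf m s x)%:E))%E.
Proof.
move=> f0 mf; have dom := normal_prob_dominates m s.
rewrite -(Radon_Nikodym_SigmaFinite.change_of_variables dom)//.
have RNi := Radon_Nikodym_SigmaFinite.f_integrable dom.
have mpdf : measurable_fun [set: R] (EFin \o normal_pdf m s).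
  by apply/measurable_EFinP; exact: measurable_normal_pdf.
apply: ae_eq_integral => //.
- by apply: emeasurable_funM => //; exact: measurable_int RNi.
- exact: emeasurable_funM.
apply: ae_eqe_mul2l; apply: integral_ae_eq => //.
by move=> A _ mA; rewrite -Radon_Nikodym_SigmaFinite.f_integral.
Qed.

Lemma is_derive_normal_pdf (R : realType) (s x : R) : s != 0 ->
  is_derive x 1 (normal_pdf 0 s) (- (x / s ^+ 2) * normal_pdf 0 s x).
Proof.
move=> s0; rewrite !normal_pdfE // /normal_fun.
apply: is_derive_eq.
rewrite /GRing.scale /= !subr0.
field.
by rewrite s0.
Qed.

Lemma continuous_sqr_normal_pdf (R : realType) (s : R) : s != 0 ->
  continuous (fun x : R => x ^+ 2 * normal_pdf 0 s x).
Proof.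
move=> s0 x; apply: cvgM; last exact: continuous_normal_pdf.
exact: exprn_continuous.
Qed.

(** The density satisfies [p' = - (x / s ^+ 2) p], so [x ^+ 2 * p] is the
    product of [- s ^+ 2 * x] and [p'], to be integrated by parts. *)
Lemma normal_pdf_by_parts (R : realType) (s b : R) : s != 0 -> 0 < b ->
  (\int[lebesgue_measure]_(x in `[0%R, b]) (x ^+ 2 * normal_pdf 0 s x)%:E =
   \int[lebesgue_measure]_(x in `[0%R, b]) (s ^+ 2 * normal_pdf 0 s x)%:E -
   (s ^+ 2 * b * normal_pdf 0 s b)%:E)%E.
Proof.
move=> s0 b0.
have dpdf x := is_derive_normal_pdf x s0.
have dlin (x : R) : is_derive x 1 (fun x : R => - s ^+ 2 * x) (- s ^+ 2).
  by apply: is_derive_eq; rewrite /GRing.scale /= mulr1.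
have deriv_cont (f f' : R -> R) :
    (forall x : R, is_derive x 1 f (f' x)) -> continuous f.
  move=> df x; apply/differentiable_continuous/derivable1_diffP.
  exact: (@ex_derive _ _ _ _ _ _ _ (df x)).
have deriv_oo (f f' : R -> R) : (forall x : R, is_derive x 1 f (f' x)) ->
    derivable_oo_LRcontinuous f 0 b.
  move=> df; have cf := deriv_cont _ _ df; split => [x _||].
  - exact: (@ex_derive _ _ _ _ _ _ _ (df x)).
  - exact/cvg_at_right_filter/cf.
  - exact/cvg_at_left_filter/cf.
have deriv_val (f f' : R -> R) : (forall x : R, is_derive x 1 f (f' x)) ->
    {in `]0, b[, f^`()%classic =1 f'}.
  by move=> df x _; rewrite derive1E; exact: (@derive_val _ _ _ _ _ _ _ (df x)).
have cpdf := @continuous_normal_pdf R 0 s s0.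
transitivity (\int[lebesgue_measure]_(x in `[0%R, b])
    ((- s ^+ 2 * x) * (- (x / s ^+ 2) * normal_pdf 0 s x))%:E)%E.
  by apply: eq_integral => x _; congr EFin; field; rewrite s0.
rewrite (@integration_by_parts R _ (normal_pdf 0 s) (cst (- s ^+ 2)))//.
- under [X in (_ - X)%E]eq_integral do rewrite /= mulNr EFinN.
  rewrite integral_ge0N/=; last first.
    by move=> x _; rewrite lee_fin mulr_ge0 ?sqr_ge0 ?normal_pdf_ge0.
  by rewrite oppeK mulr0 mul0r subr0 addeC !mulNr.
- by apply: continuous_subspaceT => x; exact: cvg_cst.
- exact: deriv_oo dlin.
- exact: deriv_val dlin.
- apply: continuous_subspaceT => x; apply: cvgM; last exact: cpdf.
  by apply: cvgN; apply: cvgM; [exact: cvg_id|exact: cvg_cst].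
- exact: deriv_oo dpdf.
- exact: deriv_val dpdf.
Qed.

(** The boundary term of the integration by parts vanishes in the limit. *)
Lemma cvg_id_normal_pdf (R : realType) (s : R) : 0 < s ->
  n%:R * normal_pdf 0 s n%:R @[n --> \oo] --> (0 : R).
Proof.
move=> s0.
have bound n : (0 < n)%N ->
    n%:R * normal_pdf 0 s n%:R <= normal_peak s * (s ^+ 2 *+ 2) * n%:R^-1.
  move=> n0; rewrite normal_pdfE ?gt_eqF// /normal_fun subr0.
  have n0' : 0 < n%:R :> R by rewrite ltr0n.
  have c0 : 0 < s ^+ 2 *+ 2 by rewrite pmulrn_lgt0// exprn_gt0.
  rewrite mulrCA -!mulrA ler_pM2l ?normal_peak_gt0 ?gt_eqF//.
  rewrite mulNr expRN ler_pdivrMr ?expR_gt0//.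
  (* With c = 2 s^2, the bound exp (n^2 / c) >= n^2 / c gives
     n exp (- n^2 / c) <= c / n. *)
  apply: le_trans (ler_wpM2l _ (expR_ge1Dx _)); last first.
    by rewrite mulr_ge0 ?invr_ge0 ?ltW.
  rewrite mulrDr mulr1 -[leLHS]add0r lerD//.
    by rewrite mulr_ge0 ?invr_ge0 ?ltW.
  by rewrite le_eqVlt; apply/orP; left; apply/eqP; field; rewrite !gt_eqF.
apply: (@squeeze_cvgr _ _ _ _ (cst 0)
  (fun n => normal_peak s * (s ^+ 2 *+ 2) * n%:R^-1)).
- near=> n; rewrite bound ?mulr_ge0 ?normal_pdf_ge0//.
  by near: n; exact: nbhs_infty_gt.
- exact: cvg_cst.
- rewrite -[X in _ --> X](mulr0 (normal_peak s * (s ^+ 2 *+ 2))).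
  apply: cvgM; first exact: cvg_cst.
  by rewrite -cvg_shiftS; exact: cvg_harmonic.
Unshelve. all: by end_near. Qed.

(** Both [x ^+ 2 * p] and [s ^+ 2 * p] are even, so it suffices to compare them
    on the half-line.  On [0, n] their integrals differ by a boundary term that
    tends to 0, and the integral of [s ^+ 2 * p] over the line is [s ^+ 2]. *)
Lemma normal_prob_second_moment (R : realType) (s : R) : 0 < s ->
  (\int[normal_prob 0 s]_x (x ^+ 2)%:E = (s ^+ 2)%:E)%E.
Proof.
move=> s0; have s_neq0 : s != 0 by rewrite gt_eqF.
rewrite ge0_integral_normal_prob; first last.
- by apply/measurable_EFinP; exact: exprn_measurable.
- by move=> x; rewrite lee_fin sqr_ge0.
under eq_integral do rewrite -EFinM.
have pdfN x : normal_pdf 0 s (- x) = normal_pdf 0 s x.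
  by rewrite !normal_pdfE// /normal_fun !subr0 sqrrN.
have x2pdf_ge0 x : 0 <= x ^+ 2 * normal_pdf 0 s x.
  by rewrite mulr_ge0 ?sqr_ge0 ?normal_pdf_ge0.
have s2pdf_ge0 x : 0 <= s ^+ 2 * normal_pdf 0 s x.
  by rewrite mulr_ge0 ?sqr_ge0 ?normal_pdf_ge0.
have cx2 := continuous_sqr_normal_pdf s_neq0.
have cs2 : continuous (fun x : R => s ^+ 2 * normal_pdf 0 s x).
  by move=> x; apply: cvgM; [exact: cvg_cst|exact: continuous_normal_pdf].
have total : (\int[lebesgue_measure]_x (s ^+ 2 * normal_pdf 0 s x)%:E =
    (s ^+ 2)%:E)%E.
  under eq_integral do rewrite EFinM.
  rewrite integralZl//; last exact: integrable_normal_pdf.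
  by rewrite integral_normal_pdf mule1.
rewrite -total !ge0_symfun_integralT//; first last.
- by move=> x; rewrite /= sqrrN pdfN.
- by move=> x; rewrite /= pdfN.
congr (_ * _)%E; rewrite -set_itvcy.
have lim1 := ge0_cvgn_integral (mu := lebesgue_measure) x2pdf_ge0
  (continuous_measurable_fun cx2).
have lim2 := ge0_cvgn_integral (mu := lebesgue_measure) s2pdf_ge0
  (continuous_measurable_fun cs2).
have boundary : (s ^+ 2 * n%:R * normal_pdf 0 s n%:R)%:E @[n --> \oo] --> 0%:E.
  apply: cvg_EFin; first exact: nearW.
  rewrite -[X in _ --> X](mulr0 (s ^+ 2)); under eq_fun do rewrite /= -mulrA.
  by apply: cvgM; [exact: cvg_cst|exact: cvg_id_normal_pdf].
have := cvgeB (fin_num_adde_defl _ (isT : - 0%:E \is a fin_num)%E)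
  lim2 boundary.
rewrite sube0 => lim3; apply: (cvg_unique _ lim1) => //.
apply: cvg_trans (lim3 _); apply: near_eq_cvg; near=> n.
rewrite /= normal_pdf_by_parts// ltr0n.
by near: n; exact: nbhs_infty_gt.
Unshelve. all: by end_near. Qed.

(** * Moments of a Gaussian vector *)

Lemma Lfun2_ge0_integral_sqr d (T : measurableType d) (R : realType)
    (P : probability T R) (X : T -> R) : measurable_fun [set: T] X ->
  (\int[P]_w (X w ^+ 2)%:E < +oo)%E -> X \in Lfun P 2%:E.
Proof.
move=> mX X2; rewrite inE; apply/andP; split; rewrite inE//=.
rewrite /finite_norm unlock /Lnorm poweR_lty//.
rewrite (eq_integral (fun w => (X w ^+ 2)%:E))// => w _.
by rewrite /= powR_mulrn// real_normK ?num_real.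
Qed.

(** Variance zero is allowed: the law is then a Dirac mass at 0. *)
Lemma normal_law_second_moment d (T : measurableType d) (R : realType)
    (P : probability T R) (X : T -> R) (v : R) : measurable_fun [set: T] X ->
  0 <= v -> (forall A, measurable A -> P (X @^-1` A) = normal_law 0 v A) ->
  (\int[P]_w (X w ^+ 2)%:E = v%:E)%E.
Proof.
move=> mX v0 lawX.
(* The normal law lives on [measurableTypeR R], whose measurable sets are those
   of [R] but whose display differs; [X] is retyped to have its law there. *)
have mX' : measurable_fun [set: T] (X : T -> measurableTypeR R) by [].
pose Xr : {RV P >-> measurableTypeR R} :=
  mfun_Sub (mem_set mX' : (X : T -> measurableTypeR R) \in mfun).
have msqr : measurable_fun [set: measurableTypeR R]
    (fun x : measurableTypeR R => ((x : R) ^+ 2)%:E).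
  by apply/measurable_EFinP; exact: exprn_measurable.
transitivity (\int[distribution P Xr]_x ((x : R) ^+ 2)%:E)%E.
  by rewrite ge0_integral_distribution// => y; rewrite lee_fin sqr_ge0.
move: v0; rewrite le_eqVlt => /orP[/eqP v0|v0].
  rewrite (eq_measure_integral (dirac (0 : measurableTypeR R))) => [|A mA _].
    by rewrite integral_dirac// diracT mul1e expr0n/= -v0.
  by rewrite [LHS]lawX// /normal_law -v0 ltxx.
rewrite (eq_measure_integral (normal_prob 0 (Num.sqrt v))) => [|A mA _].
  by rewrite normal_prob_second_moment ?sqrtr_gt0// sqr_sqrtr// ltW.
by rewrite [LHS]lawX// /normal_law v0.
Qed.

Lemma eq_law_expectation d (T : measurableType d) (R : realType)
    (P : probability T R) (X Y : T -> R) : X \in Lfun P 1 -> Y \in Lfun P 1 ->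
  (forall A, measurable A -> P (X @^-1` A) = P (Y @^-1` A)) ->
  'E_P[X]%E = 'E_P[Y]%E.
Proof.
move=> X1 Y1 XY.
have mX : measurable_fun [set: T] X by move: X1; rewrite inE => /andP[/[!inE]].
have mY : measurable_fun [set: T] Y by move: Y1; rewrite inE => /andP[/[!inE]].
pose Xr : {RV P >-> R} := mfun_Sub (mem_set mX : X \in mfun).
pose Yr : {RV P >-> R} := mfun_Sub (mem_set mY : Y \in mfun).
have iX := (Lfun1_integrable P X).1 X1.
have iY := (Lfun1_integrable P Y).1 Y1.
rewrite unlock -[LHS](integral_distribution (X := Xr) (f := EFin))//.
rewrite -[RHS](integral_distribution (X := Yr) (f := EFin))//.
by apply: eq_measure_integral => A mA _; exact: XY.
Qed.

(** All three facts are read off the functionals [Y a = a^T *m X].  The second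
    moment of [Y a] is the value at [a] of the quadratic form of [S], hence
    finite; the mean vanishes because [Y (- a) = - Y a] has the law of [Y a];
    and the quadratic form of [covmx P X] at [a] is the variance of [Y a]. *)
Lemma gaussian_vector_moments d (T : measurableType d) (R : realType)
    (P : probability T R) (q : nat) (X : T -> 'cV[R]_q) (S : 'M[R]_q) :
  S^T = S -> (forall a : 'cV[R]_q, 0 <= (a^T *m S *m a) 0 0) ->
  gaussian_vector P X 0 S ->
  [/\ square_integrable P X, Emx P X = 0 & covmx P X = S].
Proof.
move=> Ssym Spos [mX lawX].
pose Y (a : 'cV[R]_q) w := (a^T *m X w) 0 0.
have mY a : measurable_fun [set: T] (Y a).
  exact: (measurableT_comp (measurable_functional a) mX).
have lawY a A : measurable A ->
    P (Y a @^-1` A) = normal_law 0 ((a^T *m S *m a) 0 0) A.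
  by move=> mA; rewrite [LHS]lawX// mulmx0 mxE.
have Y2 a : (\int[P]_w (Y a w ^+ 2)%:E = ((a^T *m S *m a) 0 0)%:E)%E.
  by apply: normal_law_second_moment => // A mA; exact: lawY.
have L2Y a : Y a \in Lfun P 2%:E.
  by apply: Lfun2_ge0_integral_sqr => //; rewrite Y2 ltry.
have EY a : 'E_P[Y a]%E = 0%E.
  have NY : Y (- a) = \- Y a.
    by apply/funext => w; rewrite /Y raddfN /= mulNmx mxE.
  have NYE : \- Y a = -1 \o* Y a by apply/funext => w; rewrite /= mulrN1.
  have : 'E_P[Y a]%E = 'E_P[\- Y a]%E.
    apply: eq_law_expectation; rewrite -?NY ?Lfun2_Lfun1// => A mA.
    have quadN : (- a)^T *m S *m - a = a^T *m S *m a.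
      by rewrite [(- a)^T]raddfN /= mulmxN !mulNmx opprK.
    by rewrite (lawY a A mA) (lawY (- a) A mA) quadN.
  rewrite NYE expectationZl ?Lfun2_Lfun1//.
  rewrite -(fineK (expectation_fin_num (Lfun2_Lfun1 (L2Y a)))) -EFinM.
  by move=> [] ?; congr EFin; lra.
have YE i : Y (delta_mx i 0) = fun w => X w i 0.
  by apply/funext => w; rewrite /Y trmx_delta -rowE mxE.
have X2 : square_integrable P X by move=> i; rewrite -YE.
split => //.
  by apply/matrixP => i j; rewrite !mxE (ord1 j) -YE EY.
apply: quadratic_form_inj => // [|a]; first exact: covmx_tr.
transitivity (covmx P (fun w => a^T *m X w) 0 0).
  by rewrite covmx_mulmx// trmxK.
rewrite covmxE -[X in fine X]/('V_P[Y a])%E varianceE// EY.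
rewrite [X in (_ - X)%E]mul0e sube0 unlock.
by rewrite [X in fine X](Y2 a).
Qed.

(** * The derivative-free EKF time update *)

(** The columns of [XX alpha xhat S] are the sample points, so the columns of
    [FXbar] are the deviations of the propagated sample points from [g xhat]
    times [alpha / sqrt n], and a product [M *m M^T] is the sum of the outer
    products of the columns of [M]. *)
Lemma FXbar_gram (R : realType) (n : nat) (alpha : R) (xhat : 'cV[R]_n)
    (S : 'M[R]_n) (g : 'cV[R]_n -> 'cV[R]_n) :
  FXbar alpha xhat S g *m (FXbar alpha xhat S g)^T =
  (alpha ^+ 2 / n%:R) *:
    \sum_(i < n) (g (sample_point alpha xhat S i) - g xhat) *m
                 (g (sample_point alpha xhat S i) - g xhat)^T.
Proof.
have colXX i : col i (XX alpha xhat S) = sample_point alpha xhat S i.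
  apply/matrixP => k l; rewrite !mxE big_ord1 !mxE mulr1 (ord1 l).
  by rewrite [Num.sqrt _ / _]mulrC mulrA.
have FE i j : FXbar alpha xhat S g i j = alpha / Num.sqrt n%:R *
    (g (sample_point alpha xhat S j) - g xhat) i 0.
  by rewrite !mxE big_ord1 !mxE mulr1 colXX.
apply/matrixP => i j; rewrite [LHS]mxE [RHS]mxE summxE mulr_sumr.
apply: eq_bigr => k _; rewrite [X in _ * X]mxE !FE !mxE big_ord1 !mxE mulrACA.
congr (_ * _).
by rewrite mulrACA -invfM -!expr2 sqr_sqrtr.
Qed.

Lemma measurable_f_EM (R : realType) (n : nat) (f : R -> 'cV[R]_n -> 'cV[R]_n)
    (delta t : R) (i : 'I_n) :
  measurable_fun [set: borelV R n] (f t : borelV R n -> borelV R n) ->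
  measurable_fun [set: borelV R n]
    (fun v : borelV R n => f_EM f delta t (v : 'cV[R]_n) i 0).
Proof.
move=> mf; rewrite (_ : (fun _ => _) =
    (fun v : borelV R n => (v : 'cV[R]_n) i 0 + delta * f t v i 0)); last first.
  by apply/funext => v; rewrite !mxE.
apply: measurable_funD; first exact: measurable_coord.
apply: measurable_funM => //.
exact: (measurableT_comp (measurable_coord i) mf).
Qed.

Theorem lemma1
  (R : realType) (n q : nat)
  (* drift, diffusion matrix and noise intensity of the SDE *)
  (f : R -> 'cV[R]_n -> 'cV[R]_n) (G : 'M[R]_(n, q)) (Q : 'M[R]_q)
  (f_meas : forall t, measurable_fun [set: borelV R n]
                        (f t : borelV R n -> borelV R n))
  (Q_pos : posdefmx Q)
  (* sampling interval [t0, t1] and number of mesh steps *)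
  (t0 t1 : R) (t01 : t0 < t1) (L : nat) (L_pos : (0 < L)%N)
  (* probability conditional on the measurements available up to t0 *)
  (d : measure_display) (T : measurableType d) (P : probability T R)
  (x : nat -> T -> 'cV[R]_n) (dw : nat -> T -> 'cV[R]_q)
  (x0_meas : measurable_fun [set: T] (x 0%N : T -> borelV R n))
  (x0_L2 : square_integrable P (x 0%N))
  (dw_law : forall l, (l < L)%N ->
     gaussian_vector P (dw l) 0 (mesh_step t0 t1 L *: Q))
  (dw_indep : forall l, (l < L)%N -> independent_vectors P (dw l) (x l))
  (* Euler-Maruyama recursion *)
  (x_EM : forall l, (l < L)%N -> forall w,
     x l.+1 w = f_EM f (mesh_step t0 t1 L) (mesh_node t0 t1 L l) (x l w)
                + G *m dw l w)
  (fx_L2 : forall l, (l < L)%N ->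
     square_integrable P
       (fun w => f_EM f (mesh_step t0 t1 L) (mesh_node t0 t1 L l) (x l w)))
  (* state estimates, filter covariances and their square roots *)
  (xhat_init : 'cV[R]_n) (Pcov_init : 'M[R]_n)
  (xhat : nat -> 'cV[R]_n) (Pcov Psqrt : nat -> 'M[R]_n)
  (xhat_0 : xhat 0%N = xhat_init) (Pcov_0 : Pcov 0%N = Pcov_init)
  (xhat_mean : forall l, (l <= L)%N -> xhat l = Emx P (x l))
  (Pcov_cov : forall l, (l <= L)%N -> Pcov l = covmx P (x l))
  (Psqrt_spec : forall l, (l < L)%N -> Pcov l = Psqrt l *m (Psqrt l)^T)
  (* derivative-free EKF framework *)
  (alpha : R) (alpha_pos : 0 < alpha)
  (rule_mean : forall l, (l < L)%N ->
     df_ekf_mean_rule P (x l) (xhat l)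
       (f_EM f (mesh_step t0 t1 L) (mesh_node t0 t1 L l)))
  (rule_cov : forall l, (l < L)%N ->
     df_ekf_cov_rule P alpha (x l) (xhat l) (Psqrt l)
       (f_EM f (mesh_step t0 t1 L) (mesh_node t0 t1 L l))) :
  forall l, (l < L)%N ->
    [/\ xhat l.+1 = f_EM f (mesh_step t0 t1 L) (mesh_node t0 t1 L l) (xhat l),
        f_EM f (mesh_step t0 t1 L) (mesh_node t0 t1 L l) (xhat l) =
          xhat l + mesh_step t0 t1 L *: f (mesh_node t0 t1 L l) (xhat l)
      & Pcov l.+1 =
          FXbar alpha (xhat l) (Psqrt l)
            (f_EM f (mesh_step t0 t1 L) (mesh_node t0 t1 L l)) *m
          (FXbar alpha (xhat l) (Psqrt l)
            (f_EM f (mesh_step t0 t1 L) (mesh_node t0 t1 L l)))^T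
          + mesh_step t0 t1 L *: (G *m Q *m G^T)].
Proof.
move=> l lL.
have delta_ge0 : 0 <= mesh_step t0 t1 L.
  by rewrite divr_ge0 ?subr_ge0 ?ler0n// ltW.
move: (fx_L2 l lL) (rule_mean l lL) (rule_cov l lL).
rewrite (xhat_mean l.+1 lL) (Pcov_cov l.+1 lL).
rewrite /df_ekf_mean_rule /df_ekf_cov_rule -FXbar_gram.
have -> : x l.+1 = fun w =>
    f_EM f (mesh_step t0 t1 L) (mesh_node t0 t1 L l) (x l w) + G *m dw l w.
  by apply/funext => w; exact: x_EM.
set delta := mesh_step t0 t1 L in delta_ge0 *; set t := mesh_node t0 t1 L l.
move=> Y2 meanY covY.
have [Qsym Qpos] := Q_pos.
have [dw2 mean_dw cov_dw] : [/\ square_integrable P (dw l),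
    Emx P (dw l) = 0 & covmx P (dw l) = delta *: Q].
  apply: gaussian_vector_moments (dw_law l lL).
    by rewrite linearZ /= Qsym.
  move=> a; rewrite -scalemxAr -scalemxAl mxE mulr_ge0//.
  have [->|a0] := eqVneq a 0; first by rewrite mulmx0 mxE.
  exact/ltW/Qpos.
have dw1 i j : (fun w => dw l w i j) \in Lfun P 1.
  exact/Lfun2_Lfun1/square_integrable_entry.
have Gdw2 : square_integrable P (fun w => G *m dw l w).
  move=> i; apply: Lfun_mulmxl => [|k j]; first by rewrite ler1n.
  exact: square_integrable_entry.
split => //.
  rewrite EmxD => [|i j|i j].
  - by rewrite meanY Emx_mulmxl// mean_dw mulmx0 addr0.
  - exact/Lfun2_Lfun1/square_integrable_entry.
  - exact/Lfun2_Lfun1/square_integrable_entry.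
rewrite covmxD_uncorrelated// => [|i j].
  by rewrite covY covmx_mulmx// cov_dw -(scalemxAr delta) -(scalemxAl delta).
(* What remains is the vanishing covariance of coordinate [i] of the drift with
   coordinate [j] of [G *m dw l]. *)
rewrite covarianceC.
apply: (independent_vectors_covariance0 (X := dw l) (Y := x l)
  (u := fun v => (G *m (v : 'cV[R]_q)) j 0)
  (v := fun v => f_EM f delta t (v : 'cV[R]_n) i 0)) => //.
- exact: dw_indep.
- rewrite (_ : (fun _ => _) = (fun v : borelV R q =>
      ((row j G)^T^T *m (v : 'cV[R]_q)) 0 0));
    first exact: measurable_functional.
  by apply/funext => v; rewrite trmxK -row_mul [RHS]mxE.
- exact: measurable_f_EM.
Qed.
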